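(* Let $\nu>0$ be a real number. For all $u,z,w\in\mathbb{C}$ with $|u|<1$, $$\sum_{m,n=0}^{+\infty} \frac{u^m\, H_{m,n}^{\nu}(z,\overline{z})\, \overline{H_{m,n}^{\nu}(w,\overline{w})}}{\nu^{m+n}\, m!\, n!} = \frac{e^{\nu \langle w,z\rangle}}{1-u}\, \exp\left(\frac{-\nu u\,|z-w|^2}{1-u}\right).$$
   Context: For a real number $\nu>0$ and nonnegative integers $m,n$, the (weighted) univariate complex Hermite polynomials are $$H_{m,n}^{\nu}(z,\overline{z}) = (-1)^{m+n} e^{\nu z\overline{z}}\, \frac{\partial^{m+n}}{\partial \overline{z}^{m}\,\partial z^{n}}\left(e^{-\nu z\overline{z}}\right),\qquad z\in\mathbb{C},$$ where $\partial/\partial z=\frac12(\partial_x-i\partial_y)$ and $\partial/\partial\overline{z}=\frac12(\partial_x+i\partial_y)$ for $z=x+iy$ are the Wirtinger derivatives. The notation is $\langle w,z\rangle = w\overline{z}$ for $w,z\in\mathbb{C}$. *)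

(* Defs.v *)
From Stdlib Require Import Reals List.
From Coquelicot Require Import Coquelicot.

Definition Cexp (z : C) : C := (exp (Re z) * cos (Im z), exp (Re z) * sin (Im z))%R.

Definition inner (w z : C) : C := (w * Cconj z)%C.

(* Real partial derivatives of a complex-valued function on C = R^2, taken
   componentwise. [Derive] is total (junk where the derivative does not exist);
   below these operators are only iterated on a smooth function. *)
Definition Cdx (f : C -> C) (z : C) : C :=
  (Derive (fun t : R => Re (f (t, Im z))) (Re z),
   Derive (fun t : R => Im (f (t, Im z))) (Re z)).

Definition Cdy (f : C -> C) (z : C) : C :=
  (Derive (fun t : R => Re (f (Re z, t))) (Im z),
   Derive (fun t : R => Im (f (Re z, t))) (Im z)).

Definition wirtinger (f : C -> C) (z : C) : C :=
  (/ 2 * (Cdx f z - Ci * Cdy f z))%C.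

Definition wirtinger_bar (f : C -> C) (z : C) : C :=
  (/ 2 * (Cdx f z + Ci * Cdy f z))%C.

Definition hermite (nu : R) (m n : nat) (z : C) : C :=
  ((-1) ^ (m + n) * Cexp (nu * (z * Cconj z)) *
   Nat.iter m wirtinger_bar
     (Nat.iter n wirtinger (fun v : C => Cexp (- (nu * (v * Cconj v))))) z)%C.

Definition Csum {I : Type} (a : I -> C) (l : list I) : C :=
  fold_right (fun i s => (a i + s)%C) (RtoC 0) l.

(* [s] is the limit of the finite partial sums of [a], along the finite subsets
   of [I] (duplicate-free lists) ordered by inclusion. In C this unconditional
   convergence is the same as absolute convergence. *)
Definition has_sum {I : Type} (a : I -> C) (s : C) : Prop :=
  forall eps : posreal, exists l0 : list I, forall l : list I,
    NoDup l -> incl l0 l -> (Cmod (Csum a l - s)%C < eps)%R.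

(* Main.v *)
(** Rodrigues' formula gives the recursion
    [H_(m+1,n) = nu z H_(m,n) - nu n H_(m,n-1)], and a symmetric one in [n].
    Because the shift [n -> n+1] is adjoint to the lowering operator of the recursion,
    the sums [S(m,p) = sum_n H_(m,n)(z) conj(H_(p,n)(w)) / (nu^n n!)] converge and obey
    [S(m+1,p) = nu (z-w) S(m,p) + nu p S(m,p-1)] and
    [S(0,p) = exp(nu <w,z>) (nu conj(w-z))^p]; on the diagonal this yields
    [S(m,m) = exp(nu <w,z>) nu^m m! L_m(nu |z-w|^2)] with the Laguerre polynomial [L_m],
    whose generating function gives the right-hand side.
    Unconditional convergence follows from [2 |H(z) H(w)| <= |H(z)|^2 + |H(w)|^2]: for
    [w = z] the sum over [n] is just [exp(nu |z|^2)], since [L_m(0) = 1], so the dominating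
    double series is a geometric series in [|u|]. *)

Require Import Defs.
From Stdlib Require Import Reals Factorial List Permutation Lra Lia FunctionalExtensionality.
From Coquelicot Require Import Coquelicot.

(* Turns [P x -> P y] into [x = y], where [P] is read off the premise and need only be
   convertible in the conclusion. *)
Ltac convert_value :=
  match goal with
  | |- ?P ?x -> _ ?y => let H := fresh in intro H; refine (eq_ind x P H y _)
  end.

(** Lemmas on finite sums leave the operations of an abstract structure and an equality over its
    carrier; both are turned into those of [C] so that [ring] applies. *)
Ltac unfold_C :=
  change (@plus ?a) with Cplus; change (@mult ?a) with Cmult;
  change (@zero ?a) with (RtoC 0);
  match goal with |- @eq _ ?x ?y => change (@eq C x y) end.

Lemma C_ext (a b : C) : Re a = Re b -> Im a = Im b -> a = b.
Proof. destruct a, b; simpl; intros -> ->; reflexivity. Qed.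

Lemma Cexp_plus (a b : C) : Cexp (a + b) = (Cexp a * Cexp b)%C.
Proof.
  apply C_ext; unfold Cexp, Re, Im; simpl;
    rewrite exp_plus, ?cos_plus, ?sin_plus; ring.
Qed.

Lemma Cexp_0 : Cexp 0 = 1%C.
Proof.
  apply C_ext; unfold Cexp, Re, Im; simpl; rewrite exp_0, ?cos_0, ?sin_0; ring.
Qed.

Lemma Cexp_opp_mult (a : C) : (Cexp a * Cexp (- a))%C = 1%C.
Proof. rewrite <- Cexp_plus, <- Cexp_0. f_equal; ring. Qed.

(** * Wirtinger calculus *)

(** Componentwise, to match the real derivatives inside [Cdx] and [Cdy]. *)
Definition is_derive_RC (f : R -> C) (t : R) (d : C) : Prop :=
  is_derive (fun x => Re (f x)) t (Re d) /\ is_derive (fun x => Im (f x)) t (Im d).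

Lemma is_derive_RC_ext (f g : R -> C) (t : R) (d d' : C) :
  (forall x, f x = g x) -> d = d' -> is_derive_RC f t d -> is_derive_RC g t d'.
Proof. intros Hfg <-. now replace g with f by now extensionality x. Qed.

Lemma is_derive_RC_const (c : C) (t : R) : is_derive_RC (fun _ => c) t 0.
Proof.
  split; [exact (is_derive_const (V := R_NormedModule) (Re c) t)
         |exact (is_derive_const (V := R_NormedModule) (Im c) t)].
Qed.

Lemma is_derive_RC_id (t : R) : is_derive_RC RtoC t 1.
Proof. split; [exact (is_derive_id t)|exact (is_derive_const (V := R_NormedModule) 0%R t)]. Qed.

Lemma is_derive_RC_plus (f g : R -> C) (t : R) (df dg : C) :
  is_derive_RC f t df -> is_derive_RC g t dg ->
  is_derive_RC (fun x => f x + g x)%C t (df + dg).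
Proof.
  intros [f1 f2] [g1 g2]; split.
  - apply (is_derive_plus (fun x => Re (f x)) (fun x => Re (g x)) t _ _ f1 g1).
  - apply (is_derive_plus (fun x => Im (f x)) (fun x => Im (g x)) t _ _ f2 g2).
Qed.

Lemma is_derive_RC_mult (f g : R -> C) (t : R) (df dg : C) :
  is_derive_RC f t df -> is_derive_RC g t dg ->
  is_derive_RC (fun x => f x * g x)%C t (df * g t + f t * dg).
Proof.
  intros [f1 f2] [g1 g2].
  assert (M : forall (a b : R -> R) a' b', is_derive a t a' -> is_derive b t b' ->
    is_derive (fun x => a x * b x)%R t (a' * b t + a t * b')%R).
  { intros a b a' b' Ha Hb. apply (is_derive_mult a b t a' b' Ha Hb), Rmult_comm. }
  split.
  - replace (Re _) with
      (minus (Re df * Re (g t) + Re (f t) * Re dg)%R (Im df * Im (g t) + Im (f t) * Im dg)%R)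
      by (unfold Re, Im, minus, plus, opp; simpl; ring).
    apply (is_derive_minus (fun x => Re (f x) * Re (g x))%R (fun x => Im (f x) * Im (g x))%R);
      auto.
  - replace (Im _) with
      (plus (Re df * Im (g t) + Re (f t) * Im dg)%R (Im df * Re (g t) + Im (f t) * Re dg)%R)
      by (unfold Re, Im, plus; simpl; ring).
    apply (is_derive_plus (fun x => Re (f x) * Im (g x))%R (fun x => Im (f x) * Re (g x))%R);
      auto.
Qed.

Lemma is_derive_RC_Cexp (f : R -> C) (t : R) (d : C) :
  is_derive_RC f t d -> is_derive_RC (fun x => Cexp (f x)) t (d * Cexp (f t)).
Proof.
  intros [f1 f2].
  (* One product and chain rule serves both components, with [g] equal to [cos] and then [sin]. *)
  assert (K : forall g g' : R -> R, (forall y, is_derive g y (g' y)) ->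
    is_derive (fun x => exp (Re (f x)) * g (Im (f x)))%R t
      (Re d * exp (Re (f t)) * g (Im (f t)) +
       exp (Re (f t)) * (Im d * g' (Im (f t))))%R).
  { intros g g' Hg.
    refine (is_derive_mult (fun x => exp (Re (f x))) (fun x => g (Im (f x))) t _ _ _ _ Rmult_comm).
    - refine (is_derive_comp exp (fun x => Re (f x)) t _ _ (is_derive_exp _) f1).
    - refine (is_derive_comp g (fun x => Im (f x)) t _ _ (Hg _) f2). }
  split; simpl.
  - generalize (K cos (fun y => - sin y)%R is_derive_cos).
    convert_value; unfold Cexp, Re, Im; simpl; ring.
  - generalize (K sin cos is_derive_sin).
    convert_value; unfold Cexp, Re, Im; simpl; ring.
Qed.

(** The third and fourth arguments are the values of the derivatives in [z] and [conj z]. *)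
Definition is_wirtinger (f : C -> C) (z a b : C) : Prop :=
  is_derive_RC (fun t => f (t, Im z)) (Re z) (a + b) /\
  is_derive_RC (fun t => f (Re z, t)) (Im z) (Ci * (a - b)).

Lemma Ci_mult_Ci : (Ci * Ci)%C = (- 1)%C.
Proof. apply C_ext; unfold Re, Im; simpl; ring. Qed.

(** With [a + b] and [Ci * (a - b)] as the two real partial derivatives, [Ci * Ci = -1] makes the
    Wirtinger combinations collapse to [2 * a] and [2 * b], before halving. *)
Lemma is_wirtinger_unique (f : C -> C) (z a b : C) :
  is_wirtinger f z a b -> wirtinger f z = a /\ wirtinger_bar f z = b.
Proof.
  intros [[x1 x2] [y1 y2]].
  assert (Hx : Cdx f z = (a + b)%C).
  { apply C_ext; unfold Cdx; cbn -[Cplus]; apply is_derive_unique; assumption. }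
  assert (Hy : Cdy f z = (Ci * (a - b))%C).
  { apply C_ext; unfold Cdy; cbn -[Cminus Cmult Ci]; apply is_derive_unique; assumption. }
  unfold wirtinger, wirtinger_bar; rewrite Hx, Hy, !Cmult_assoc.
  assert (H2 : RtoC 2 <> 0%C) by (intro H; apply RtoC_inj in H; lra).
  split.
  - replace (a + b - Ci * Ci * (a - b))%C with (2 * a)%C by (rewrite Ci_mult_Ci; ring).
    field; exact H2.
  - replace (a + b + Ci * Ci * (a - b))%C with (2 * b)%C by (rewrite Ci_mult_Ci; ring).
    field; exact H2.
Qed.

Lemma is_wirtinger_const (c z : C) : is_wirtinger (fun _ => c) z 0 0.
Proof.
  split.
  - replace (0 + 0)%C with (RtoC 0) by ring. apply is_derive_RC_const.
  - replace (Ci * (0 - 0))%C with (RtoC 0) by ring. apply is_derive_RC_const.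
Qed.

Lemma is_wirtinger_id (z : C) : is_wirtinger (fun v => v) z 1 0.
Proof.
  split; split; simpl; auto_derive; trivial; unfold Re, Im; simpl; ring.
Qed.

Lemma is_wirtinger_conj (z : C) : is_wirtinger Cconj z 0 1.
Proof.
  split; split; simpl; auto_derive; trivial; unfold Re, Im; simpl; ring.
Qed.

Lemma is_wirtinger_plus (f g : C -> C) (z a b c d : C) :
  is_wirtinger f z a b -> is_wirtinger g z c d ->
  is_wirtinger (fun v => f v + g v)%C z (a + c) (b + d).
Proof.
  intros [f1 f2] [g1 g2]; split.
  - replace (a + c + (b + d))%C with (a + b + (c + d))%C by ring.
    now apply is_derive_RC_plus.
  - replace (Ci * (a + c - (b + d)))%C with (Ci * (a - b) + Ci * (c - d))%C by ring.
    now apply is_derive_RC_plus.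
Qed.

Lemma is_wirtinger_mult (f g : C -> C) (z a b c d : C) :
  is_wirtinger f z a b -> is_wirtinger g z c d ->
  is_wirtinger (fun v => f v * g v)%C z (a * g z + f z * c) (b * g z + f z * d).
Proof.
  intros [f1 f2] [g1 g2]; split.
  - generalize (is_derive_RC_mult _ _ _ _ _ f1 g1). cbv beta.
    (* The factors are evaluated at [(Re z, Im z)], which is folded back to [z]. *)
    rewrite <- surjective_pairing. convert_value; ring.
  - generalize (is_derive_RC_mult _ _ _ _ _ f2 g2). cbv beta.
    rewrite <- surjective_pairing. convert_value; ring.
Qed.

Lemma is_wirtinger_Cexp (f : C -> C) (z a b : C) :
  is_wirtinger f z a b ->
  is_wirtinger (fun v => Cexp (f v)) z (a * Cexp (f z)) (b * Cexp (f z)).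
Proof.
  intros [f1 f2]; split.
  - generalize (is_derive_RC_Cexp _ _ _ f1). cbv beta.
    rewrite <- surjective_pairing. convert_value; ring.
  - generalize (is_derive_RC_Cexp _ _ _ f2). cbv beta.
    rewrite <- surjective_pairing. convert_value; ring.
Qed.

Lemma is_wirtinger_scal (c : C) (f : C -> C) (z a b : C) :
  is_wirtinger f z a b -> is_wirtinger (fun v => c * f v)%C z (c * a) (c * b).
Proof.
  intro H. generalize (is_wirtinger_mult _ _ _ _ _ _ _ (is_wirtinger_const c z) H).
  replace (0 * f z + c * a)%C with (c * a)%C by ring.
  now replace (0 * f z + c * b)%C with (c * b)%C by ring.
Qed.

Lemma is_wirtinger_conj_pow (c : C) (n : nat) (z : C) :
  is_wirtinger (fun v => (c * Cconj v) ^ n)%C z 0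
    (INR n * c * (c * Cconj z) ^ (pred n)).
Proof.
  induction n as [|n IH].
  - simpl. replace (0 * c * 1)%C with (RtoC 0) by ring. apply is_wirtinger_const.
  - generalize (is_wirtinger_mult _ _ _ _ _ _ _
      (is_wirtinger_scal c _ _ _ _ (is_wirtinger_conj z)) IH).
    cbv beta.
    replace (c * 0 * (c * Cconj z) ^ n + c * Cconj z * 0)%C with (RtoC 0) by ring.
    convert_value.
    rewrite S_INR, RtoC_plus. simpl pred.
    (* For [n = 0] the factor [INR n] kills the term with [pred n]; otherwise the power absorbs one
       more factor. *)
    destruct n as [|n]; simpl pred; [simpl|rewrite (Cpow_S _ n)]; ring.
Qed.

(** * The recursion for the Hermite polynomials *)

(** At [n = 0] the meaningless index [pred n] is harmless, being multiplied by [INR n]. *)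
Fixpoint hermite_rec (nu : R) (m n : nat) (z : C) : C :=
  match m with
  | O => ((nu * Cconj z) ^ n)%C
  | S m' => (nu * z * hermite_rec nu m' n z
             - nu * INR n * hermite_rec nu m' (pred n) z)%C
  end.

(** The [conj z] derivative passes through the recursion to the indices [n] and [pred n], where
    induction applies. The [z] derivative stays anonymous: Rodrigues' formula applies all [z]
    derivatives first, to the Gaussian alone. *)
Lemma is_wirtinger_hermite_rec (nu : R) (m n : nat) (z : C) :
  exists a, is_wirtinger (hermite_rec nu m n) z a
              (nu * INR n * hermite_rec nu m (pred n) z).
Proof.
  revert n; induction m as [|m IH]; intro n.
  - exists 0%C. generalize (is_wirtinger_conj_pow nu n z).
    simpl. convert_value; ring.
  - destruct (IH n) as [a Ha], (IH (pred n)) as [b Hb].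
    eexists.
    generalize (is_wirtinger_plus _ _ _ _ _ _ _
      (is_wirtinger_mult _ _ _ _ _ _ _
        (is_wirtinger_scal nu _ _ _ _ (is_wirtinger_id z)) Ha)
      (is_wirtinger_scal (- (nu * INR n)) _ _ _ _ Hb)).
    replace (fun v => _) with (hermite_rec nu (S m) n)
      by (extensionality v; simpl; ring).
    convert_value. simpl. ring.
Qed.

Definition gauss (nu : R) (v : C) : C := Cexp (- (nu * (v * Cconj v))).

Lemma is_wirtinger_gauss (nu : R) (z : C) :
  is_wirtinger (gauss nu) z (- (nu * Cconj z) * gauss nu z) (- (nu * z) * gauss nu z).
Proof.
  generalize (is_wirtinger_Cexp _ _ _ _ (is_wirtinger_scal (- nu) _ _ _ _
    (is_wirtinger_mult _ _ _ _ _ _ _ (is_wirtinger_id z) (is_wirtinger_conj z)))).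
  replace (fun v => Cexp (- nu * (v * Cconj v))) with (gauss nu)
    by (extensionality v; unfold gauss; f_equal; ring).
  replace (Cexp (- nu * (z * Cconj z))) with (gauss nu z)
    by (unfold gauss; f_equal; ring).
  replace (- nu * (1 * Cconj z + z * 0) * gauss nu z)%C
    with (- (nu * Cconj z) * gauss nu z)%C by ring.
  convert_value; ring.
Qed.

(** Powers of [Cconj v] are constants for the [z] derivative, so each derivative only brings down
    another [- nu * Cconj v] from the Gaussian. *)
Lemma iter_wirtinger_gauss (nu : R) (n : nat) :
  Nat.iter n wirtinger (gauss nu) = (fun v => (- nu * Cconj v) ^ n * gauss nu v)%C.
Proof.
  induction n as [|n IH]; extensionality v.
  - simpl. ring.
  - simpl Nat.iter. rewrite IH.
    refine (eq_trans (proj1 (is_wirtinger_unique _ _ _ _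
      (is_wirtinger_mult _ _ _ _ _ _ _ (is_wirtinger_conj_pow (- nu) n v)
        (is_wirtinger_gauss nu v)))) _).
    rewrite Cpow_S. ring.
Qed.

(** Differentiating the polynomial lowers [n], differentiating the Gaussian multiplies by
    [- nu * v]; together this is minus the recursion in [m], whence the sign. *)
Lemma iter_wirtinger_bar_gauss (nu : R) (m n : nat) :
  Nat.iter m wirtinger_bar (fun v => (- nu * Cconj v) ^ n * gauss nu v)%C =
  (fun v => (-1) ^ (m + n) * (hermite_rec nu m n v * gauss nu v))%C.
Proof.
  induction m as [|m IH]; extensionality v.
  - simpl. rewrite Cmult_assoc, <- Cpow_mult_l. do 2 f_equal. ring.
  - simpl Nat.iter. rewrite IH.
    destruct (is_wirtinger_hermite_rec nu m n v) as [a Ha].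
    refine (eq_trans (proj2 (is_wirtinger_unique _ _ _ _
      (is_wirtinger_scal _ _ _ _ _ (is_wirtinger_mult _ _ _ _ _ _ _ Ha
        (is_wirtinger_gauss nu v))))) _).
    cbn [Nat.add hermite_rec]. rewrite Cpow_S. ring.
Qed.

Lemma hermite_eq_rec (nu : R) (m n : nat) (z : C) :
  hermite nu m n z = hermite_rec nu m n z.
Proof.
  unfold hermite.
  change (fun v : C => Cexp (- (nu * (v * Cconj v)))) with (gauss nu).
  rewrite iter_wirtinger_gauss, iter_wirtinger_bar_gauss.
  unfold gauss.
  assert (E : ((-1) ^ (m + n) * (-1) ^ (m + n))%C = 1%C).
  { rewrite <- Cpow_mult_l. replace (-1 * -1)%C with (RtoC 1) by ring. apply Cpow_1_l. }
  transitivity (((-1) ^ (m + n) * (-1) ^ (m + n)) *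
    (Cexp (nu * (z * Cconj z)) * Cexp (- (nu * (z * Cconj z)))) * hermite_rec nu m n z)%C.
  - ring.
  - rewrite E, Cexp_opp_mult. ring.
Qed.

Lemma hermite_rec_S_r (nu : R) (m n : nat) (z : C) :
  hermite_rec nu m (S n) z =
  (nu * Cconj z * hermite_rec nu m n z - nu * INR m * hermite_rec nu (pred m) n z)%C.
Proof.
  revert n; induction m as [|m IH]; intro n.
  - simpl. ring.
  - change (hermite_rec nu (S m) (S n) z) with
      (nu * z * hermite_rec nu m (S n) z - nu * INR (S n) * hermite_rec nu m n z)%C.
    change (hermite_rec nu (S m) n z) with
      (nu * z * hermite_rec nu m n z - nu * INR n * hermite_rec nu m (pred n) z)%C.
    rewrite IH, !S_INR, !RtoC_plus. simpl (pred (S m)).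
    (* Multiplied by [INR m], the recursion holds for [m = 0] too; likewise below with [INR n]. *)
    assert (Hm : (INR m * hermite_rec nu m n z)%C =
      (INR m * (nu * z * hermite_rec nu (pred m) n z
                - nu * INR n * hermite_rec nu (pred m) (pred n) z))%C).
    { destruct m; [simpl; ring|reflexivity]. }
    assert (Hn : (INR n * hermite_rec nu m n z)%C =
      (INR n * (nu * Cconj z * hermite_rec nu m (pred n) z
                - nu * INR m * hermite_rec nu (pred m) (pred n) z))%C).
    { destruct n; [simpl; ring|rewrite IH; reflexivity]. }
    transitivity (nu * z * nu * Cconj z * hermite_rec nu m n z
      - nu * (INR m * (nu * z * hermite_rec nu (pred m) n z
                       - nu * INR n * hermite_rec nu (pred m) (pred n) z))
      - nu * (nu * INR m * INR n * hermite_rec nu (pred m) (pred n) z)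
      - nu * (INR n * hermite_rec nu m n z) - nu * hermite_rec nu m n z)%C; [ring|].
    rewrite <- Hm, Hn. ring.
Qed.
(** * Complex series and the exponential series *)

Lemma Cmod_le_Re_Im (c : C) : Cmod c <= Rabs (Re c) + Rabs (Im c).
Proof.
  replace c with (Re c + Ci * Im c)%C at 1
    by (apply C_ext; unfold Re, Im; simpl; ring).
  eapply Rle_trans; [apply Cmod_triangle|].
  rewrite Cmod_mult, Cmod_Ci, !Cmod_R. lra.
Qed.

(** The mean value theorem is applied to the real and imaginary parts separately, at possibly
    different points; adding the two bounds costs the factor 2. *)
Lemma mean_value_RC (f df : R -> C) (M : R) :
  (forall t, is_derive_RC f t (df t)) ->
  (forall t, 0 <= t <= 1 -> Cmod (df t) <= M) -> Cmod (f 1 - f 0) <= 2 * M.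
Proof.
  intros Hf HM.
  assert (K : forall p : C -> R, (forall a b, p (a - b)%C = p a - p b) ->
    (forall a, Rabs (p a) <= Cmod a) ->
    (forall t, is_derive (fun x => p (f x)) t (p (df t))) ->
    Rabs (p (f 1 - f 0)%C) <= M).
  { intros p Hp Hle Hd. rewrite Hp.
    destruct (MVT_gen (fun x => p (f x)) 0 1 (fun x => p (df x))) as (c & Hc & E).
    - intros x _. apply Hd.
    - intros x _. apply continuity_pt_filterlim.
      apply (ex_derive_continuous (fun x => p (f x))). now exists (p (df x)).
    - rewrite E, Rminus_0_r, Rmult_1_r.
      eapply Rle_trans; [apply Hle|apply HM].
      now rewrite Rmin_left, Rmax_right in Hc by lra. }
  eapply Rle_trans; [apply Cmod_le_Re_Im|].
  apply (Rle_trans _ (M + M)); [apply Rplus_le_compat|lra].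
  - apply K; [reflexivity|apply re_le_Cmod|intro t; apply (proj1 (Hf t))].
  - apply K; [reflexivity| |intro t; apply (proj2 (Hf t))].
    intro a. eapply Rle_trans; [apply Rmax_r|apply Rmax_Cmod].
Qed.

Lemma exp_le (x y : R) : x <= y -> exp x <= exp y.
Proof. intros [H| ->]; [left; now apply exp_increasing|apply Rle_refl]. Qed.

Definition Cseries (a : nat -> C) (l : C) : Prop := is_series (V := C_NormedModule) a l.

Lemma Cseries_ball (a : nat -> C) (l : C) :
  Cseries a l <->
  forall eps : posreal, eventually (fun N => Cmod (sum_n a N - l) < eps).
Proof. exact (filterlim_locally_ball_norm (U := C_NormedModule) (sum_n a) l). Qed.

Lemma Cseries_ext (a b : nat -> C) (l l' : C) :
  (forall n, a n = b n) -> l = l' -> Cseries a l -> Cseries b l'.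
Proof. intros H <-. now apply is_series_ext. Qed.

Lemma Cseries_plus (a b : nat -> C) (l l' : C) :
  Cseries a l -> Cseries b l' -> Cseries (fun n => a n + b n)%C (l + l').
Proof. exact (is_series_plus (V := C_NormedModule) a b l l'). Qed.

Lemma Cseries_scal (c : C) (a : nat -> C) (l : C) :
  Cseries a l -> Cseries (fun n => c * a n)%C (c * l).
Proof. exact (is_series_scal (V := C_NormedModule) c a l). Qed.

Lemma Cseries_decr_1 (a : nat -> C) (l : C) :
  Cseries (fun n => a (S n)) (l - a O) -> Cseries a l.
Proof. exact (is_series_decr_1 (V := C_NormedModule) a l). Qed.

Lemma Cseries_unique (a : nat -> C) (l l' : C) : Cseries a l -> Cseries a l' -> l = l'.
Proof.
  intros H H'. exact (filterlim_locally_unique (K := C_AbsRing) (V := C_NormedModule) _ _ _ H H').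
Qed.

Lemma sum_n_Re (a : nat -> C) (N : nat) : sum_n (fun n => Re (a n)) N = Re (sum_n a N).
Proof.
  induction N as [|N IH]; [now rewrite !sum_O|].
  rewrite !sum_Sn, IH. reflexivity.
Qed.

Lemma Cseries_Re (a : nat -> C) (l : C) :
  Cseries a l -> is_series (fun n => Re (a n)) (Re l).
Proof.
  intro H. apply filterlim_locally. intro eps.
  generalize (proj1 (Cseries_ball a l) H eps). apply filter_imp. intros N HN.
  change (Rabs (sum_n (fun n => Re (a n)) N - Re l) < eps).
  rewrite sum_n_Re. eapply Rle_lt_trans; [|exact HN]. apply (re_le_Cmod (sum_n a N - l)%C).
Qed.

Lemma RtoC_fact_neq_0 (n : nat) : RtoC (INR (fact n)) <> 0%C.
Proof. intro H. apply RtoC_inj in H. now apply (INR_fact_neq_0 n). Qed.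

Lemma RtoC_S_neq_0 (n : nat) : RtoC (INR (S n)) <> 0%C.
Proof. intro H. apply RtoC_inj in H. revert H. apply not_0_INR. discriminate. Qed.

Lemma RtoC_fact_S (n : nat) : RtoC (INR (fact (S n))) = (INR (S n) * INR (fact n))%C.
Proof. rewrite fact_simpl, mult_INR, RtoC_mult. reflexivity. Qed.

Lemma Cmod_Cexp (a : C) : Cmod (Cexp a) = exp (Re a).
Proof.
  unfold Cmod, Cexp; simpl fst; simpl snd.
  replace (_ + _)%R with (exp (Re a) ^ 2 * (Rsqr (sin (Im a)) + Rsqr (cos (Im a))))%R
    by (unfold Rsqr; ring).
  rewrite sin2_cos2, Rmult_1_r. apply sqrt_pow2. left. apply exp_pos.
Qed.

(** Multiplied by [Cexp (- t z)], the partial sums of the exponential series at [t z]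
    have a derivative in which all but the last term cancel. *)
Lemma is_derive_RC_exp_partial (z : C) (N : nat) (t : R) :
  is_derive_RC
    (fun t => Cexp (- z * t) * sum_n (fun n => (z * t) ^ n / INR (fact n)) N)%C t
    (- z * Cexp (- z * t) * ((z * t) ^ N / INR (fact N))).
Proof.
  assert (D : forall c : C, is_derive_RC (fun t => c * t)%C t c).
  { intro c. generalize (is_derive_RC_mult _ _ _ _ _ (is_derive_RC_const c t) (is_derive_RC_id t)).
    convert_value. ring. }
  assert (DP : forall n, is_derive_RC (fun t => (z * t) ^ n)%C t
                (INR n * z * (z * t) ^ pred n)).
  { intro n; induction n as [|n IH].
    - generalize (is_derive_RC_const 1 t). convert_value. simpl; ring.
    - generalize (is_derive_RC_mult _ _ _ _ _ (D z) IH). convert_value.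
      rewrite S_INR, RtoC_plus. simpl pred.
      destruct n as [|n]; simpl pred; [simpl|rewrite (Cpow_S _ n)]; ring. }
  pose proof (is_derive_RC_Cexp _ _ _ (D (- z)%C)) as DE. cbv beta in DE.
  induction N as [|N IH].
  - refine (is_derive_RC_ext _ _ _ _ _ _ _ DE).
    + intro x. rewrite sum_O. simpl. field.
    + simpl. field.
  - refine (is_derive_RC_ext _ _ _ _ _ _ _ (is_derive_RC_plus _ _ _ _ _ IH
      (is_derive_RC_mult _ _ _ _ _ DE
        (is_derive_RC_mult _ _ _ _ _ (DP (S N)) (is_derive_RC_const (/ INR (fact (S N))) t))))).
    + intro x. rewrite sum_Sn.
      unfold_C.
      unfold Cdiv. ring.
    + simpl pred. rewrite RtoC_fact_S. field.
      split; [apply RtoC_fact_neq_0|apply RtoC_S_neq_0].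
Qed.

(** With [F] the product differentiated above, [F 0 = 1] and [Cexp z * F 1] is the partial sum. The
    error is thus [Cexp z * (F 1 - F 0)], which the mean value bound controls by a multiple of
    [Cmod z ^ N / N!]. *)
Lemma Cseries_exp (z : C) : Cseries (fun n => z ^ n / INR (fact n))%C (Cexp z).
Proof.
  apply Cseries_ball. intro eps.
  set (K := (Cmod (Cexp z) * (2 * (Cmod z * exp (Cmod z))))%R).
  assert (HK : 0 <= K).
  { repeat (apply Rmult_le_pos || apply Cmod_ge_0 || lra).
    left; apply exp_pos. }
  assert (Hbd : forall N, Cmod (sum_n (fun n => z ^ n / INR (fact n))%C N - Cexp z)
                 <= K * (/ INR (fact N) * Cmod z ^ N)).
  { intro N.
    set (F := fun t : R =>
      (Cexp (- z * t) * sum_n (fun n => (z * t) ^ n / INR (fact n)) N)%C).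
    assert (F0 : F 0 = 1%C).
    { unfold F. rewrite !Cmult_0_r, Cexp_0, Cmult_1_l. induction N as [|N IH].
      - rewrite sum_O. simpl. field.
      - rewrite sum_Sn, IH. rewrite Cpow_S.
        change (1 + 0 * 0 ^ N / INR (fact (S N)) = 1)%C. unfold Cdiv. ring. }
    assert (F1 : (Cexp z * F 1)%C = sum_n (fun n => z ^ n / INR (fact n))%C N).
    { unfold F. rewrite Cmult_assoc.
      replace (- z * 1)%C with (- z)%C by ring.
      rewrite Cexp_opp_mult, Cmult_1_l. apply sum_n_ext. intro n. now rewrite Cmult_1_r. }
    assert (HM : Cmod (F 1 - F 0) <=
              2 * (Cmod z * exp (Cmod z) * (/ INR (fact N) * Cmod z ^ N))).
    { apply (mean_value_RC F _ _ (is_derive_RC_exp_partial z N)).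
      intros t Ht.
      assert (Hzt : Cmod (z * t) <= Cmod z).
      { rewrite Cmod_mult, Cmod_R, Rabs_pos_eq by lra.
        rewrite <- (Rmult_1_r (Cmod z)) at 2.
        apply Rmult_le_compat_l; [apply Cmod_ge_0|lra]. }
      rewrite !Cmod_mult, Cmod_opp, Cmod_Cexp, Cmod_div, Cmod_pow, Cmod_R
        by apply RtoC_fact_neq_0.
      rewrite (Rabs_pos_eq (INR (fact N))) by apply pos_INR.
      unfold Rdiv. rewrite (Rmult_comm _ (/ INR (fact N))).
      assert (0 < / INR (fact N)) by apply Rinv_0_lt_compat, INR_fact_lt_0.
      repeat apply Rmult_le_compat; try apply Cmod_ge_0; try lra;
        try (left; apply exp_pos).
      - apply Rmult_le_pos; [apply Cmod_ge_0|left; apply exp_pos].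
      - apply Rmult_le_pos; [lra|apply pow_le, Cmod_ge_0].
      - apply exp_le. eapply Rle_trans; [apply Rle_abs|].
        eapply Rle_trans; [apply re_le_Cmod|].
        replace (- z * t)%C with (- (z * t))%C by ring. now rewrite Cmod_opp.
      - apply pow_le, Cmod_ge_0.
      - apply pow_incr; split; [apply Cmod_ge_0|exact Hzt]. }
    rewrite F0 in HM. rewrite <- F1.
    replace (Cexp z * F 1 - Cexp z)%C with (Cexp z * (F 1 - 1))%C by ring.
    rewrite Cmod_mult. unfold K. rewrite Rmult_assoc.
    apply Rmult_le_compat_l; [apply Cmod_ge_0|]. lra. }
  assert (L : is_lim_seq (fun N => K * (/ INR (fact N) * Cmod z ^ N)) 0).
  { replace (Finite 0) with (Rbar_mult K 0) by (simpl; f_equal; ring).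
    apply is_lim_seq_scal_l, ex_series_lim_0.
    (* The bound tends to 0 as the general term of the convergent real exponential series. *)
    exists (exp (Cmod z)). apply is_pseries_R, is_exp_Reals. }
  apply is_lim_seq_spec in L. generalize (L eps). apply filter_imp. intros N HN.
  eapply Rle_lt_trans; [apply Hbd|].
  rewrite Rminus_0_r in HN. apply (Rle_lt_trans _ _ _ (Rle_abs _) HN).
Qed.

(** * The pairing of two Hermite families *)

Definition hermite_weight (nu : R) (n : nat) : C := (/ (nu ^ n * INR (fact n)))%C.

Lemma RtoC_neq_0 (x : R) : x <> 0 -> RtoC x <> 0%C.
Proof. intros Hx H. now apply RtoC_inj in H. Qed.

(** For the pairing with weights [1 / (nu^n n!)], the shift [n -> n+1] is adjoint to the
    lowering operator [f |-> (n |-> nu n f (n-1))] occurring in [hermite_rec]. *)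
Lemma Cseries_weight_shift (nu : R) (f g : nat -> C) (s : C) : nu <> 0 ->
  Cseries (fun n => f n * g (S n) * hermite_weight nu n)%C s ->
  Cseries (fun n => nu * INR n * f (pred n) * g n * hermite_weight nu n)%C s.
Proof.
  intros Hnu H. apply Cseries_decr_1. revert H. apply Cseries_ext.
  - intro n. unfold hermite_weight. rewrite RtoC_fact_S, Cpow_S. simpl pred.
    field. repeat split.
    + apply RtoC_fact_neq_0.
    + apply RtoC_S_neq_0.
    + now apply Cpow_nz, RtoC_neq_0.
    + now apply RtoC_neq_0.
  - simpl. ring.
Qed.

Lemma Cconj_RtoC (x : R) : Cconj x = x.
Proof. apply C_ext; unfold Re, Im; simpl; ring. Qed.

Lemma Cconj_hermite_rec_S_l (nu : R) (p n : nat) (w : C) :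
  Cconj (hermite_rec nu (S p) n w) =
  (nu * Cconj w * Cconj (hermite_rec nu p n w)
   - nu * INR n * Cconj (hermite_rec nu p (pred n) w))%C.
Proof. simpl. now rewrite Cminus_conj, !Cmult_conj, !Cconj_RtoC. Qed.

Lemma Cconj_hermite_rec_S_r (nu : R) (p n : nat) (w : C) :
  Cconj (hermite_rec nu p (S n) w) =
  (nu * w * Cconj (hermite_rec nu p n w)
   - nu * INR p * Cconj (hermite_rec nu (pred p) n w))%C.
Proof.
  now rewrite hermite_rec_S_r, Cminus_conj, !Cmult_conj, !Cconj_RtoC, Cconj_conj.
Qed.

(** The pairing stripped of its exponential factor, with [a] for [nu * (z - w)] and [b] for
    [nu * (Cconj w - Cconj z)]. *)
Fixpoint pairing_rec (nu : R) (a b : C) (m p : nat) : C :=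
  match m with
  | O => (b ^ p)%C
  | S m' => (a * pairing_rec nu a b m' p + nu * INR p * pairing_rec nu a b m' (pred p))%C
  end.

Lemma hermite_pairing (nu : R) (z w : C) (m p : nat) : nu <> 0 ->
  Cseries
    (fun n => hermite_rec nu m n z * Cconj (hermite_rec nu p n w) * hermite_weight nu n)%C
    (Cexp (nu * inner w z) *
     pairing_rec nu (nu * (z - w)) (nu * (Cconj w - Cconj z)) m p).
Proof.
  intro Hnu. set (E := Cexp (nu * inner w z)).
  set (a := (nu * (z - w))%C). set (b := (nu * (Cconj w - Cconj z))%C).
  revert p; induction m as [|m IH]; intro p.
  - induction p as [|p IH].
    (* For [m = p = 0] the pairing is the exponential series of [nu * inner w z]. *)
    + refine (Cseries_ext _ _ _ _ _ _ (Cseries_exp (nu * inner w z))).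
      * intro n. simpl. rewrite Cpow_conj, Cmult_conj, Cconj_RtoC, Cconj_conj.
        unfold inner, hermite_weight. rewrite !Cpow_mult_l. field.
        split; [apply RtoC_fact_neq_0|now apply Cpow_nz, RtoC_neq_0].
      * simpl. symmetry. apply Cmult_1_r.
    (* The recursion in [p] is used on the [w] side; its lowering term becomes a shift on the [z]
       side, which for [m = 0] is multiplication by [nu * Cconj z]. *)
    + refine (Cseries_ext _ _ _ _ _ _ (Cseries_plus _ _ _ _
        (Cseries_scal (nu * Cconj w) _ _ IH)
        (Cseries_scal (-1) _ _ (Cseries_weight_shift nu
          (fun n => Cconj (hermite_rec nu p n w)) (fun n => hermite_rec nu 0 n z) _ Hnu
          (Cseries_ext _ _ _ _ _ eq_refl (Cseries_scal (nu * Cconj z) _ _ IH)))))).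
      * intro n. cbv beta. rewrite Cconj_hermite_rec_S_l. ring.
      * simpl. unfold b. ring.
      * intro n. simpl. ring.
  (* Roles are exchanged: the lowering term of the recursion in [m] becomes a shift on the [w] side,
     expanded by [Cconj_hermite_rec_S_r]. *)
  - refine (Cseries_ext _ _ _ _ _ _ (Cseries_plus _ _ _ _
      (Cseries_scal (nu * z) _ _ (IH p))
      (Cseries_scal (-1) _ _ (Cseries_weight_shift nu
        (fun n => hermite_rec nu m n z) (fun n => Cconj (hermite_rec nu p n w)) _ Hnu
        (Cseries_ext _ _ _ _ _ eq_refl (Cseries_plus _ _ _ _
          (Cseries_scal (nu * w) _ _ (IH p))
          (Cseries_scal (- (nu * INR p)) _ _ (IH (pred p))))))))).
    + intro n. simpl. ring.
    + simpl. unfold a. ring.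
    + intro n. cbv beta. rewrite Cconj_hermite_rec_S_r. ring.
Qed.

(** * Binomial sums and the Laguerre form of the pairing *)

Fixpoint binom (n k : nat) : nat :=
  match n, k with
  | _, O => 1
  | O, S _ => 0
  | S n', S k' => binom n' k' + binom n' (S k')
  end.

Lemma binom_0_r (n : nat) : binom n 0 = 1%nat.
Proof. now destruct n. Qed.

Lemma binom_gt (n k : nat) : (n < k)%nat -> binom n k = 0%nat.
Proof.
  revert k; induction n as [|n IH]; intros [|k] H; simpl; try lia.
  rewrite !IH by lia. reflexivity.
Qed.

Lemma sum_n_split_first {G : AbelianMonoid} (f : nat -> G) (N : nat) :
  sum_n f (S N) = plus (f O) (sum_n (fun j => f (S j)) N).
Proof.
  induction N as [|N IH].
  - now rewrite sum_Sn, !sum_O.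
  - now rewrite sum_Sn, IH, (sum_Sn (fun j => f (S j))), plus_assoc.
Qed.

(** With [T j i] read as [X^j Y^i], this is the expansion of [(X + Y)^(m+1)] as [(X + Y)^m (X + Y)];
    the proof is Pascal's rule. *)
Lemma binom_sum_S (T : nat -> nat -> C) (m : nat) :
  sum_n (fun j => INR (binom (S m) j) * T j (S m - j)%nat)%C (S m) =
  sum_n (fun j => INR (binom m j) * (T (S j) (m - j)%nat + T j (S (m - j))))%C m.
Proof.
  assert (E : sum_n (fun j => INR (binom m j) * T j (S (m - j)))%C m =
    (T O (S m) + sum_n (fun j => INR (binom m (S j)) * T (S j) (m - j)%nat) m)%C).
  { transitivity (sum_n (fun j => INR (binom m j) * T j (S m - j)%nat)%C (S m)).
    - rewrite sum_Sn, binom_gt by lia. simpl (INR 0). rewrite Cmult_0_l.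
      rewrite (plus_zero_r (G := C_AbelianGroup)).
      apply sum_n_ext_loc. intros j Hj. now rewrite Nat.sub_succ_l.
    - rewrite sum_n_split_first, binom_0_r. simpl (INR 1). now rewrite Cmult_1_l. }
  rewrite sum_n_split_first.
  transitivity (sum_n (fun j => INR (binom m j) * T (S j) (m - j)%nat)%C m +
                sum_n (fun j => INR (binom m j) * T j (S (m - j)))%C m)%C.
  - rewrite E, binom_0_r. simpl (INR 1). rewrite Cmult_1_l.
    transitivity (T 0%nat (S m) +
      (sum_n (fun j => INR (binom m j) * T (S j) (m - j)%nat)%C m +
       sum_n (fun j => INR (binom m (S j)) * T (S j) (m - j)%nat)%C m))%C; [|unfold_C; ring].
    apply (f_equal2 Cplus); [reflexivity|].
    rewrite <- (sum_n_plus (G := C_AbelianMonoid)).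
    apply sum_n_ext. intro j. simpl (binom (S m) (S j)).
    rewrite plus_INR, RtoC_plus. unfold_C.
    simpl Nat.sub. ring.
  - rewrite <- (sum_n_plus (G := C_AbelianMonoid)).
    apply sum_n_ext. intro j. unfold_C. ring.
Qed.

(** The value at [b] of the [i]-th derivative of [x^p]. *)
Fixpoint pow_derive (b : C) (i p : nat) : C :=
  match i with
  | O => (b ^ p)%C
  | S i' => (INR p * pow_derive b i' (pred p))%C
  end.

(** A division-free form of [(i+j)! / j! * b^j]. *)
Lemma pow_derive_add (b : C) (i j : nat) :
  (pow_derive b i (i + j) * INR (fact j) = INR (fact (i + j)) * b ^ j)%C.
Proof.
  induction i as [|i IH]; [simpl; ring|].
  cbn [pow_derive Nat.add]. simpl pred.
  rewrite RtoC_fact_S, <- !Cmult_assoc, <- IH. ring.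
Qed.

(** Each step in [m] applies the sum of two commuting operators to [b^p]: multiplication by [a], and
    [nu] times the derivative in [b]. The binomial theorem expands their [m]-th power. *)
Lemma pairing_rec_eq (nu : R) (a b : C) (m p : nat) :
  pairing_rec nu a b m p =
  sum_n (fun j => INR (binom m j) * (a ^ j * nu ^ (m - j) * pow_derive b (m - j) p))%C m.
Proof.
  revert p; induction m as [|m IH]; intro p.
  - rewrite sum_O. simpl. ring.
  - rewrite (binom_sum_S (fun j i => a ^ j * nu ^ i * pow_derive b i p)%C).
    cbn [pairing_rec]. rewrite !IH.
    rewrite <- !(sum_n_mult_l (K := C_Ring)).
    rewrite <- (sum_n_plus (G := C_AbelianMonoid)).
    apply sum_n_ext. intro j.
    unfold_C.
    cbn [pow_derive Cpow]. ring.
Qed.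

(** [laguerre m (- x)] is the classical Laguerre polynomial [L_m] at [x]. *)
Definition laguerre (m : nat) (y : C) : C :=
  sum_n (fun j => INR (binom m j) * (y ^ j / INR (fact j)))%C m.

Lemma pairing_rec_diag (nu : R) (a b : C) (m : nat) : nu <> 0 ->
  pairing_rec nu a b m m = (nu ^ m * INR (fact m) * laguerre m (a * b / nu))%C.
Proof.
  intro Hnu. rewrite pairing_rec_eq. unfold laguerre.
  rewrite <- (sum_n_mult_l (K := C_Ring)).
  apply sum_n_ext_loc. intros j Hj. unfold_C.
  pose proof (pow_derive_add b (m - j) j) as E.
  rewrite Nat.sub_add in E by exact Hj.
  replace (nu ^ m)%C with (nu ^ (m - j) * nu ^ j)%C
    by (rewrite <- Cpow_add_r; f_equal; lia).
  unfold Cdiv. rewrite !Cpow_mult_l, Cpow_inv by now apply RtoC_neq_0.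
  transitivity (INR (binom m j) * a ^ j * nu ^ (m - j) *
    (pow_derive b (m - j) m * INR (fact j)) / INR (fact j))%C.
  - field. apply RtoC_fact_neq_0.
  - rewrite E. field. split; [apply RtoC_fact_neq_0|now apply Cpow_nz, RtoC_neq_0].
Qed.

Lemma laguerre_0 (m : nat) : laguerre m 0 = 1%C.
Proof.
  unfold laguerre. destruct m as [|m].
  - rewrite sum_O. simpl. field.
  - rewrite sum_n_split_first.
    rewrite (sum_n_ext _ (fun _ => zero (G := C_AbelianMonoid))).
    + unfold sum_n. rewrite sum_n_m_const_zero.
      rewrite (plus_zero_r (G := C_AbelianGroup)). simpl. field.
    + intro j. rewrite Cpow_S. unfold_C. unfold Cdiv. ring.
Qed.

Lemma hermite_pairing_diag (nu : R) (z w : C) (m : nat) : nu <> 0 ->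
  Cseries
    (fun n => hermite_rec nu m n z * Cconj (hermite_rec nu m n w) * hermite_weight nu n)%C
    (Cexp (nu * inner w z) *
     (nu ^ m * INR (fact m) * laguerre m (- (nu * RtoC (Cmod (z - w)) ^ 2)))).
Proof.
  intro Hnu. refine (Cseries_ext _ _ _ _ (fun _ => eq_refl) _ (hermite_pairing _ _ _ _ _ Hnu)).
  rewrite pairing_rec_diag by exact Hnu. do 3 f_equal.
  (* Here [a * b / nu] is the Laguerre argument, and [(z - w) * (Cconj w - Cconj z)] is minus the
     squared modulus of [z - w]. *)
  rewrite <- RtoC_pow, Cmod2_conj, Cminus_conj. field. now apply RtoC_neq_0.
Qed.

(** * Unconditional sums over pairs *)

(** Generic in the monoid, to cover both the complex terms, where it is convertible to [Csum], and
    their real majorants. *)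
Definition lsum {G : AbelianMonoid} {I : Type} (f : I -> G) (l : list I) : G :=
  fold_right (fun i s => plus (f i) s) zero l.

Lemma lsum_app {G : AbelianMonoid} {I : Type} (f : I -> G) (l l' : list I) :
  lsum f (l ++ l') = plus (lsum f l) (lsum f l').
Proof.
  induction l as [|i l IH]; simpl; [now rewrite plus_zero_l|].
  now rewrite IH, plus_assoc.
Qed.

Lemma lsum_perm {G : AbelianMonoid} {I : Type} (f : I -> G) (l l' : list I) :
  Permutation l l' -> lsum f l = lsum f l'.
Proof.
  induction 1; simpl; congruence || auto.
  now rewrite !plus_assoc, (plus_comm (f x)).
Qed.

Lemma lsum_seq {G : AbelianMonoid} (f : nat -> G) (N : nat) :
  lsum f (seq 0 (S N)) = sum_n f N.
Proof.
  induction N as [|N IH].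
  - rewrite sum_O. simpl. apply plus_zero_r.
  - rewrite seq_S, lsum_app, IH, sum_Sn. simpl. now rewrite plus_zero_r.
Qed.

Lemma lsum_list_prod {G : AbelianMonoid} {I J : Type} (f : I * J -> G)
    (l : list I) (l' : list J) :
  lsum f (list_prod l l') = lsum (fun i => lsum (fun j => f (i, j)) l') l.
Proof.
  induction l as [|i l IH]; simpl; [reflexivity|].
  rewrite lsum_app, IH. f_equal.
  clear. induction l' as [|j l' IH]; simpl; [reflexivity|]. now rewrite IH.
Qed.

Definition grid (M N : nat) : list (nat * nat) := list_prod (seq 0 (S M)) (seq 0 (S N)).

Lemma lsum_grid {G : AbelianMonoid} (f : nat * nat -> G) (M N : nat) :
  lsum f (grid M N) = sum_n (fun m => sum_n (fun n => f (m, n)) N) M.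
Proof.
  unfold grid. rewrite lsum_list_prod, lsum_seq.
  apply sum_n_ext. intro m. apply (lsum_seq (fun n => f (m, n))).
Qed.

Lemma NoDup_list_prod {I J : Type} (l : list I) (l' : list J) :
  NoDup l -> NoDup l' -> NoDup (list_prod l l').
Proof.
  intros Hl Hl'. induction Hl as [|i l Hi Hl IH]; simpl; [constructor|].
  apply NoDup_app; [|exact IH|].
  - apply NoDup_map_NoDup_ForallPairs; [|exact Hl'].
    intros j j' _ _ E. now injection E.
  - intros [i' j] H1 H2. apply in_map_iff in H1. destruct H1 as (j' & E & _).
    injection E as -> _. apply in_prod_iff in H2. tauto.
Qed.

Lemma NoDup_grid (M N : nat) : NoDup (grid M N).
Proof. apply NoDup_list_prod; apply seq_NoDup. Qed.

Lemma incl_grid (l : list (nat * nat)) :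
  exists K, forall M N, (K <= M)%nat -> (K <= N)%nat -> incl l (grid M N).
Proof.
  induction l as [|[m n] l [K IH]].
  - exists O. intros M N _ _ p [].
  - exists (Nat.max K (Nat.max m n)). intros M N HM HN p [<-|Hp].
    + apply in_prod; apply in_seq; lia.
    + apply IH; [lia|lia|exact Hp].
Qed.

Lemma NoDup_incl_split {I : Type} (l0 l : list I) :
  NoDup l0 -> incl l0 l -> exists r, Permutation l (l0 ++ r).
Proof.
  intro H0. revert l. induction H0 as [|i l0 Hi H0 IH]; intros l Hl.
  - exists l. apply Permutation_refl.
  - destruct (in_split i l (Hl i (or_introl eq_refl))) as (l1 & l2 & ->).
    destruct (IH (l1 ++ l2)) as [r Hr].
    + intros j Hj. assert (Hj' := Hl j (or_intror Hj)).
      apply in_app_iff in Hj'. apply in_app_iff. simpl in Hj'.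
      destruct Hj' as [|[<-|]]; auto. contradiction.
    + exists r. simpl. rewrite <- Permutation_middle. now constructor.
Qed.

Lemma lsum_nonneg {I : Type} (f : I -> R) (l : list I) :
  (forall i, 0 <= f i) -> 0 <= lsum (G := R_AbelianMonoid) f l.
Proof.
  intro Hf. induction l as [|i l IH]; simpl; [apply Rle_refl|].
  apply Rplus_le_le_0_compat; auto.
Qed.

Lemma lsum_le_incl {I : Type} (f : I -> R) (l0 l : list I) :
  (forall i, 0 <= f i) -> NoDup l0 -> incl l0 l ->
  lsum (G := R_AbelianMonoid) f l0 <= lsum (G := R_AbelianMonoid) f l.
Proof.
  intros Hf Hl0 Hl. destruct (NoDup_incl_split l0 l Hl0 Hl) as [r Hr].
  rewrite (lsum_perm f _ _ Hr), lsum_app.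
  pose proof (lsum_nonneg f r Hf) as Hr0.
  change (@plus ?G) with Rplus. lra.
Qed.

Lemma Cmod_Csum_le {I : Type} (a : I -> C) (b : I -> R) (l : list I) :
  (forall i, Cmod (a i) <= b i) -> Cmod (Csum a l) <= lsum (G := R_AbelianMonoid) b l.
Proof.
  intro H. induction l as [|i l IH]; simpl.
  - rewrite Cmod_0. apply Rle_refl.
  - eapply Rle_trans; [apply Cmod_triangle|]. now apply Rplus_le_compat.
Qed.

(** For fixed [M] the grid sums converge in [N] to [sum_n r M], and these converge to [s]. How large
    [N] must be depends on [M], hence the nested [eventually]. *)
Lemma iterated_series_grid {K : AbsRing} {V : NormedModule K}
    (a : nat * nat -> V) (r : nat -> V) (s : V) (P : V -> Prop) :
  (forall m, is_series (fun n => a (m, n)) (r m)) -> is_series r s -> locally s P ->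
  eventually (fun M => eventually (fun N => P (lsum a (grid M N)))).
Proof.
  intros Ha Hr HP.
  assert (H : forall M, filterlim (fun N => lsum a (grid M N)) eventually
                          (locally (sum_n r M))).
  { intro M.
    apply (filterlim_ext (fun N => sum_n (fun m => sum_n (fun n => a (m, n)) N) M)).
    { intro N. symmetry. apply lsum_grid. }
    induction M as [|M IH].
    - rewrite sum_O. apply (filterlim_ext (fun N => sum_n (fun n => a (O, n)) N)).
      + intro N. now rewrite sum_O.
      + apply Ha.
    - rewrite sum_Sn.
      apply (filterlim_ext (fun N => plus (sum_n (fun m => sum_n (fun n => a (m, n)) N) M)
                                          (sum_n (fun n => a (S M, n)) N))).
      + intro N. now rewrite sum_Sn.
      + eapply filterlim_comp_2; [exact IH|apply Ha|apply filterlim_plus]. }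
  (* For large [M], [P] must hold on a whole neighbourhood of [sum_n r M], so that the limit in [N]
     can be used. *)
  apply locally_locally in HP.
  apply (filter_imp (F := eventually) (fun M => locally (sum_n r M) P)); [|exact (Hr _ HP)].
  intros M HM. exact (H M _ HM).
Qed.

(** A grid is chosen whose [a]-sum is within [eps / 2] of [s] and whose [b]-sum exceeds
    [T - eps / 2]. As no finite [b]-sum exceeds [T], all further terms together contribute less than
    [eps / 2]. *)
Lemma has_sum_of_iterated (a : nat * nat -> C) (b : nat * nat -> R)
    (r : nat -> C) (B : nat -> R) (s : C) (T : R) :
  (forall i, Cmod (a i) <= b i) ->
  (forall m, is_series (fun n => b (m, n)) (B m)) -> is_series B T ->
  (forall m, Cseries (fun n => a (m, n)) (r m)) -> Cseries r s ->
  has_sum a s.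
Proof.
  intros Hab Hb HB Ha Hr eps.
  assert (Hb0 : forall i, 0 <= b i)
    by (intro i; eapply Rle_trans; [apply Cmod_ge_0|apply Hab]).
  set (sb := lsum (G := R_AbelianMonoid) b).
  (* A list with [b]-sum above [T] would lie in a large grid with a smaller sum, contradicting
     monotonicity. *)
  assert (Hsup : forall l, NoDup l -> sb l <= T).
  { intros l Hl. apply Rnot_lt_le. intro Hlt.
    destruct (iterated_series_grid (V := R_NormedModule) b B T (fun y => y < sb l)
                Hb HB (open_lt (sb l) T Hlt)) as [M0 HM].
    destruct (incl_grid l) as [K HK].
    destruct (HM (Nat.max M0 K) (Nat.le_max_l _ _)) as [N0 HN].
    specialize (HN (Nat.max N0 K) (Nat.le_max_l _ _)).
    apply (Rlt_not_le _ _ HN). apply lsum_le_incl; auto.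
    apply HK; apply Nat.le_max_r. }
  pose proof (iterated_series_grid (V := R_NormedModule) b B T (fun y => T - eps / 2 < y)
                Hb HB (open_gt (T - eps / 2) T ltac:(destruct eps; simpl; lra))) as E1.
  pose proof (iterated_series_grid (V := C_NormedModule) a r s
     (fun y => Cmod (y - s) < pos_div_2 eps) Ha Hr
     (locally_ball_norm (V := C_NormedModule) s (pos_div_2 eps))) as E2.
  destruct (filter_and _ _ E1 E2) as [M HM].
  destruct (HM M (le_n M)) as [H1 H2].
  destruct (filter_and _ _ H1 H2) as [N HN].
  destruct (HN N (le_n N)) as [Hlow Hclose].
  exists (grid M N). intros l Hl Hincl.
  destruct (NoDup_incl_split _ _ (NoDup_grid M N) Hincl) as [t Ht].
  assert (Ea : Csum a l = (Csum a (grid M N) + Csum a t)%C).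
  { transitivity (Csum a (grid M N ++ t)).
    - exact (lsum_perm (G := C_AbelianMonoid) a _ _ Ht).
    - exact (lsum_app (G := C_AbelianMonoid) a (grid M N) t). }
  assert (Eb : sb l = (sb (grid M N) + sb t)%R).
  { unfold sb. rewrite (lsum_perm (G := R_AbelianMonoid) b _ _ Ht).
    exact (lsum_app (G := R_AbelianMonoid) b (grid M N) t). }
  pose proof (Cmod_Csum_le a b t Hab) as Ht1. fold (sb t) in Ht1.
  pose proof (Hsup l Hl) as Ht2.
  change (Cmod (Csum a (grid M N) - s) < eps / 2) in Hclose.
  change (T - eps / 2 < sb (grid M N)) in Hlow.
  rewrite Ea.
  replace (Csum a (grid M N) + Csum a t - s)%C
    with ((Csum a (grid M N) - s) + Csum a t)%C by ring.
  eapply Rle_lt_trans; [apply Cmod_triangle|]. lra.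
Qed.

Lemma sum_n_stable {G : AbelianMonoid} (f : nat -> G) (m N : nat) :
  (m <= N)%nat -> (forall j, (m < j)%nat -> f j = zero) -> sum_n f N = sum_n f m.
Proof.
  intros Hm Hf. induction Hm as [|N HN IH]; [reflexivity|].
  rewrite sum_Sn, Hf, plus_zero_r by lia. exact IH.
Qed.

(** The unconditional sum is read along square grids; after exchanging the finite sums, each column
    stops at the diagonal. *)
Lemma Cseries_of_has_sum_triangular (c : nat * nat -> C) (s : C) :
  (forall j m, (m < j)%nat -> c (j, m) = 0%C) -> has_sum c s ->
  Cseries (fun m => sum_n (fun j => c (j, m)) m) s.
Proof.
  intros Hc Hs. apply Cseries_ball. intro eps.
  destruct (Hs eps) as [l0 Hl0]. destruct (incl_grid l0) as [K HK].
  exists K. intros M HM.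
  replace (sum_n (fun m => sum_n (fun j => c (j, m)) m) M) with (Csum c (grid M M)).
  { apply Hl0; [apply NoDup_grid|now apply HK]. }
  transitivity (lsum (G := C_AbelianMonoid) c (grid M M)); [reflexivity|].
  rewrite lsum_grid, sum_n_switch. apply sum_n_ext_loc. intros m Hm.
  apply sum_n_stable; [exact Hm|]. intros j Hj. now apply Hc.
Qed.

(** * The generating function of the Laguerre polynomials *)

Lemma binom_mul_pow_le (t : R) (m j : nat) : 0 <= t -> INR (binom m j) * t ^ j <= (1 + t) ^ m.
Proof.
  intro Ht. revert j; induction m as [|m IH]; intros [|j].
  - simpl. lra.
  - simpl. lra.
  - rewrite binom_0_r. simpl INR. simpl (t ^ 0). rewrite Rmult_1_r.
    apply pow_R1_Rle. lra.
  - simpl binom. rewrite plus_INR.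
    pose proof (Rmult_le_compat_l t _ _ Ht (IH j)) as H1. specialize (IH (S j)).
    simpl pow in *. lra.
Qed.

Lemma ex_Cseries_binom (u : C) (j : nat) :
  Cmod u < 1 -> exists l, Cseries (fun m => INR (binom m j) * u ^ m)%C l.
Proof.
  intro Hu. pose proof (Cmod_ge_0 u) as Hu0.
  (* This choice keeps [(1 + t) * Cmod u] below 1, so a geometric series dominates. *)
  set (t := ((1 - Cmod u) / 2)%R). assert (Ht : 0 < t) by (unfold t; lra).
  apply (ex_series_le (V := C_CompleteNormedModule) _
           (fun m => / t ^ j * ((1 + t) * Cmod u) ^ m)%R).
  - intro m. change (Cmod (INR (binom m j) * u ^ m) <= / t ^ j * ((1 + t) * Cmod u) ^ m)%R.
    rewrite Cmod_mult, Cmod_pow, Cmod_R, Rabs_pos_eq, Rpow_mult_distr by apply pos_INR.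
    rewrite <- Rmult_assoc. apply Rmult_le_compat_r; [now apply pow_le|].
    pose proof (pow_lt t j Ht) as Htj.
    apply (Rmult_le_reg_r (t ^ j)); [exact Htj|].
    replace (/ t ^ j * (1 + t) ^ m * t ^ j)%R with ((1 + t) ^ m)%R by (field; lra).
    apply binom_mul_pow_le. lra.
  - exists (/ t ^ j * / (1 - (1 + t) * Cmod u))%R.
    refine (is_series_scal (V := R_NormedModule) (/ t ^ j)%R _ _ (is_series_geom _ _)).
    rewrite Rabs_pos_eq by (apply Rmult_le_pos; lra).
    unfold t. nra.
Qed.

Lemma one_minus_neq_0 (u : C) : Cmod u < 1 -> (1 - u)%C <> 0%C.
Proof.
  intros Hu H. assert (E : u = 1%C) by (transitivity (1 - (1 - u))%C; [ring|rewrite H; ring]).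
  rewrite E, Cmod_1 in Hu. lra.
Qed.

(** Once convergence is known, Pascal's rule gives a linear equation for the sum [l]:
    [l = 1 + u * l] for [j = 0], and then [u] times the previous sum plus [u * l]. Dividing by
    [1 - u] solves it. *)
Lemma Cseries_binom (u : C) (j : nat) : Cmod u < 1 ->
  Cseries (fun m => INR (binom m j) * u ^ m)%C (u ^ j / (1 - u) ^ S j).
Proof.
  intro Hu. pose proof (one_minus_neq_0 u Hu) as Hu1.
  induction j as [|j IH].
  - destruct (ex_Cseries_binom u 0 Hu) as [l Hl].
    refine (Cseries_ext _ _ _ _ (fun _ => eq_refl) _ Hl).
    assert (E : l = (1 + u * l)%C).
    { apply (Cseries_unique _ _ _ Hl). apply Cseries_decr_1.
      refine (Cseries_ext _ _ _ _ _ _ (Cseries_scal u _ _ Hl)).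
      - intro n. rewrite !binom_0_r. simpl. ring.
      - simpl. ring. }
    transitivity ((l - u * l) / (1 - u))%C; [field; exact Hu1|].
    rewrite E at 1. simpl. field. exact Hu1.
  - destruct (ex_Cseries_binom u (S j) Hu) as [l Hl].
    refine (Cseries_ext _ _ _ _ (fun _ => eq_refl) _ Hl).
    assert (E : l = (u * (u ^ j / (1 - u) ^ S j) + u * l)%C).
    { apply (Cseries_unique _ _ _ Hl). apply Cseries_decr_1.
      refine (Cseries_ext _ _ _ _ _ _
        (Cseries_plus _ _ _ _ (Cseries_scal u _ _ IH) (Cseries_scal u _ _ Hl))).
      - intro n. simpl binom. rewrite plus_INR, RtoC_plus, Cpow_S. ring.
      - simpl. ring. }
    transitivity ((l - u * l) / (1 - u))%C; [field; exact Hu1|].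
    rewrite E at 1. simpl. field. split; [now apply Cpow_nz|exact Hu1].
Qed.

Lemma Cseries_binom_exp (u y : C) : Cmod u < 1 ->
  Cseries (fun j => y ^ j / INR (fact j) * (u ^ j / (1 - u) ^ S j))%C
    (/ (1 - u) * Cexp (y * u / (1 - u))).
Proof.
  intro Hu. pose proof (one_minus_neq_0 u Hu) as Hu1.
  refine (Cseries_ext _ _ _ _ _ eq_refl
    (Cseries_scal (/ (1 - u)) _ _ (Cseries_exp (y * u / (1 - u))))).
  intro n. unfold Cdiv. rewrite !Cpow_mult_l, Cpow_inv, Cpow_S by exact Hu1.
  field.
  repeat split; exact Hu1 || apply RtoC_fact_neq_0 || now apply Cpow_nz.
Qed.

(** The triangular double series is summed over [m] first by [Cseries_binom] and then over [j] by
    the exponential series; absolute convergence permits the other order, which yields the Laguerre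
    polynomials. *)
Lemma laguerre_generating (u y : C) : Cmod u < 1 ->
  Cseries (fun m => u ^ m * laguerre m y)%C (/ (1 - u) * Cexp (y * u / (1 - u))).
Proof.
  intro Hu.
  set (term := fun (v x : C) (jm : nat * nat) =>
    (x ^ fst jm / INR (fact (fst jm)) * (INR (binom (snd jm) (fst jm)) * v ^ snd jm))%C).
  assert (Hrow : forall v x, Cmod v < 1 -> forall j, Cseries (fun m => term v x (j, m))
                  (x ^ j / INR (fact j) * (v ^ j / (1 - v) ^ S j))%C).
  { intros v x Hv j. apply Cseries_scal, Cseries_binom, Hv. }
  assert (Hu' : Cmod (RtoC (Cmod u)) < 1)
    by (rewrite Cmod_R, Rabs_pos_eq; [exact Hu|apply Cmod_ge_0]).
  assert (HS : has_sum (term u y) (/ (1 - u) * Cexp (y * u / (1 - u)))%C).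
  (* The majorant is the same array at [Cmod u] and [Cmod y], so the same row and total sums apply
     to it. *)
  { refine (has_sum_of_iterated _ (fun i => Re (term (Cmod u) (Cmod y) i)) _ _ _ _ _
      (fun j => Cseries_Re _ _ (Hrow _ (RtoC (Cmod y)) Hu' j))
      (Cseries_Re _ _ (Cseries_binom_exp _ _ Hu'))
      (Hrow u y Hu) (Cseries_binom_exp u y Hu)).
    intros [j m]. unfold term; simpl fst; simpl snd.
    rewrite <- !RtoC_pow, <- RtoC_div, <- !RtoC_mult by apply INR_fact_neq_0. simpl Re.
    rewrite !Cmod_mult, Cmod_div, !Cmod_pow, !Cmod_R by apply RtoC_fact_neq_0.
    rewrite !Rabs_pos_eq by apply pos_INR. apply Rle_refl. }
  refine (Cseries_ext _ _ _ _ _ eq_refl (Cseries_of_has_sum_triangular _ _ _ HS)).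
  - intro m. unfold laguerre. rewrite <- (sum_n_mult_l (K := C_Ring)).
    apply sum_n_ext. intro j. unfold_C. unfold term; simpl fst; simpl snd. ring.
  - intros j m H. unfold term; simpl fst; simpl snd. rewrite binom_gt by exact H.
    simpl INR. ring.
Qed.

(** * Absolute convergence and the double sum *)

Lemma Re_RtoC_mult (x : R) (c : C) : Re (x * c) = (x * Re c)%R.
Proof. unfold Re; simpl; ring. Qed.

(** The diagonal pairing at [w = z], where the Laguerre factor is 1. *)
Lemma hermite_norm_series (nu : R) (z : C) (m : nat) : 0 < nu ->
  is_series (fun n => Cmod (hermite_rec nu m n z) ^ 2 / (nu ^ n * INR (fact n)))%R
    (nu ^ m * INR (fact m) * Re (Cexp (nu * inner z z)))%R.
Proof.
  intro Hnu. assert (Hnu0 : nu <> 0) by lra.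
  pose proof (Cseries_Re _ _ (hermite_pairing_diag nu z z m Hnu0)) as H.
  replace (- (nu * RtoC (Cmod (z - z)) ^ 2))%C with (RtoC 0) in H.
  2: { replace (z - z)%C with (RtoC 0) by ring. rewrite Cmod_0. simpl. ring. }
  rewrite laguerre_0 in H.
  replace (Re (Cexp (nu * inner z z) * (nu ^ m * INR (fact m) * 1)))
    with (nu ^ m * INR (fact m) * Re (Cexp (nu * inner z z)))%R in H.
  - revert H. apply is_series_ext. intro n.
    unfold hermite_weight. rewrite <- Cmod2_conj, <- RtoC_pow, <- RtoC_mult, <- RtoC_inv, <- RtoC_mult;
      [reflexivity|].
    apply Rmult_integral_contrapositive_currified; [now apply pow_nonzero|apply INR_fact_neq_0].
  - rewrite <- Re_RtoC_mult. f_equal. rewrite RtoC_mult, RtoC_pow. ring.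
Qed.

Theorem theorem3p1 (nu : R) (hnu : (0 < nu)%R) (u z w : C) (hu : (Cmod u < 1)%R) :
  has_sum
    (fun mn : nat * nat =>
       let (m, n) := mn in
       (u ^ m * hermite nu m n z * Cconj (hermite nu m n w) /
        (RtoC nu ^ (m + n) * INR (fact m) * INR (fact n)))%C)
    (Cexp (nu * inner w z) / (1 - u) *
     Cexp (- (nu * u * RtoC (Cmod (z - w)) ^ 2) / (1 - u)))%C.
Proof.
  assert (Hnu0 : nu <> 0) by lra.
  assert (HnuC : RtoC nu <> 0%C) by now apply RtoC_neq_0.
  pose proof (one_minus_neq_0 u hu) as Hu1.
  set (y := (- (nu * RtoC (Cmod (z - w)) ^ 2))%C).
  set (q := Cmod u). assert (Hq : 0 <= q) by apply Cmod_ge_0.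
  set (e := fun v => Re (Cexp (nu * inner v v))).
  refine (has_sum_of_iterated _
    (fun mn => q ^ fst mn / (2 * (nu ^ fst mn * INR (fact (fst mn)))) *
      (Cmod (hermite_rec nu (fst mn) (snd mn) z) ^ 2 / (nu ^ snd mn * INR (fact (snd mn))) +
       Cmod (hermite_rec nu (fst mn) (snd mn) w) ^ 2 / (nu ^ snd mn * INR (fact (snd mn)))))%R
    (fun m => Cexp (nu * inner w z) * (u ^ m * laguerre m y))%C
    (fun m => (e z + e w) / 2 * q ^ m)%R _ ((e z + e w) / 2 * / (1 - q))%R _ _ _ _ _).
  - intros [m n]. simpl fst; simpl snd. rewrite !hermite_eq_rec.
    assert (Hm : 0 < nu ^ m * INR (fact m))
      by (apply Rmult_lt_0_compat; [now apply pow_lt|apply INR_fact_lt_0]).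
    assert (Hn : 0 < nu ^ n * INR (fact n))
      by (apply Rmult_lt_0_compat; [now apply pow_lt|apply INR_fact_lt_0]).
    replace (RtoC nu ^ (m + n) * INR (fact m) * INR (fact n))%C
      with (RtoC ((nu ^ m * INR (fact m)) * (nu ^ n * INR (fact n))))
      by (rewrite !RtoC_mult, !RtoC_pow, Cpow_add_r; ring).
    assert (Hmn := Rmult_lt_0_compat _ _ Hm Hn).
    rewrite Cmod_div by (apply RtoC_neq_0; lra).
    rewrite !Cmod_mult, Cmod_conj, Cmod_pow, Cmod_R, (Rabs_pos_eq (_ * _)) by lra.
    fold q. set (A := Cmod (hermite_rec nu m n z)). set (A' := Cmod (hermite_rec nu m n w)).
    set (X := (nu ^ m * INR (fact m))%R) in *. set (Y := (nu ^ n * INR (fact n))%R) in *.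
    (* The majorant exceeds the modulus of the term by a nonnegative multiple of [(A - A') ^ 2]. *)
    replace (q ^ m / (2 * X) * (A ^ 2 / Y + A' ^ 2 / Y))%R
      with (q ^ m * A * A' / (X * Y) + q ^ m * (A - A') ^ 2 / (2 * (X * Y)))%R
      by (field; lra).
    assert (0 <= q ^ m * (A - A') ^ 2 / (2 * (X * Y))); [|lra].
    apply Rmult_le_pos.
    + apply Rmult_le_pos; [now apply pow_le|apply pow2_ge_0].
    + left. apply Rinv_0_lt_compat. lra.
  - intro m. simpl fst; simpl snd.
    (* The norm series produce [nu ^ m * INR (fact m)], which cancels the weight and leaves a
       geometric term in [q]. *)
    replace ((e z + e w) / 2 * q ^ m)%R
      with (q ^ m / (2 * (nu ^ m * INR (fact m))) *
             (nu ^ m * INR (fact m) * e z + nu ^ m * INR (fact m) * e w))%R.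
    + refine (is_series_scal (V := R_NormedModule)
        (q ^ m / (2 * (nu ^ m * INR (fact m))))%R _ _
        (is_series_plus (V := R_NormedModule) _ _ _ _
          (hermite_norm_series nu z m hnu) (hermite_norm_series nu w m hnu))).
    + field. split; [apply INR_fact_neq_0|now apply pow_nonzero].
  - refine (is_series_scal (V := R_NormedModule) ((e z + e w) / 2)%R _ _ (is_series_geom _ _)).
    now rewrite Rabs_pos_eq.
  - intro m.
    (* For fixed [m] the remaining weight in [m] cancels against the diagonal pairing, leaving
       [u ^ m * laguerre m y]. *)
    refine (Cseries_ext _ _ _ _ _ _ (Cseries_scal (u ^ m / (nu ^ m * INR (fact m))) _ _
      (hermite_pairing_diag nu z w m Hnu0))).
    + intro n. rewrite !hermite_eq_rec, Cpow_add_r. unfold hermite_weight. field.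
      repeat split; (apply RtoC_fact_neq_0 || now apply Cpow_nz).
    + fold y. field. split; [apply RtoC_fact_neq_0|now apply Cpow_nz].
  - refine (Cseries_ext _ _ _ _ (fun _ => eq_refl) _
      (Cseries_scal (Cexp (nu * inner w z)) _ _ (laguerre_generating u y hu))).
    replace (y * u / (1 - u))%C with (- (nu * u * RtoC (Cmod (z - w)) ^ 2) / (1 - u))%C
      by (unfold y; field; exact Hu1).
    unfold Cdiv. ring.
Qed.
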